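(* Let $G$ be the set of all CPTP maps $\Phi:L(\mathbb{C}^2)\to L(\mathbb{C}^2)$ that are invertible with an inverse $\Phi^{-1}$ that is also CPTP, regarded as a group under composition. Every $\Phi\in G$ has the form $\Phi(\cdot)=\mathcal{U}(\cdot)\,\mathcal{U}^*$ for some $\mathcal{U}\in SU(2)$, and the assignment $\Phi\mapsto\mathcal{R}$, where $$\mathcal{R}_{kj}=\tfrac12\operatorname{Tr}(\mathcal{U}\sigma_j\,\mathcal{U}^*\sigma_k),\qquad j,k\in\{1,2,3\},$$ is well defined (independent of the choice of $\mathcal{U}\in SU(2)$ representing $\Phi$) and is a group isomorphism from $G$ onto the rotation group $SO(3)$.
   Context: $L(\mathbb{C}^n)$ denotes the space of linear operators on $\mathbb{C}^n$. A linear map $\Phi:L(\mathbb{C}^n)\to L(\mathbb{C}^m)$ is CPTP (completely positive and trace-preserving) if $\operatorname{Tr}(\Phi(X))=\operatorname{Tr}(X)$ for all $X\in L(\mathbb{C}^n)$ and, for every positive integer $q$, the map $\Phi\otimes \mathrm{id}_{L(\mathbb{C}^q)}$ sends positive semidefinite operators on $\mathbb{C}^n\otimes\mathbb{C}^q$ to positive semidefinite operators on $\mathbb{C}^m\otimes\mathbb{C}^q$. $\sigma_1,\sigma_2,\sigma_3$ are the Pauli matrices, and $^*$ denotes the conjugate transpose (adjoint). *)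

(* Defs.v *)
From HB Require Import structures.
From mathcomp Require Import all_boot all_order all_algebra.
From mathcomp Require Import sesquilinear spectral.
From mathcomp Require Import boolp reals.
From mathcomp.real_closed Require Export complex.
From mathcomp.real_closed Require Import mxtens.
Set Implicit Arguments.
Unset Strict Implicit.
Unset Printing Implicit Defensive.
Import Order.TTheory GRing.Theory Num.Theory.
Local Open Scope ring_scope.
Local Open Scope sesquilinear_scope.

(* L(C^n) is the space of matrices 'M[C]_n, linear maps between such spaces
   are elements of 'Hom('M[C]_n, 'M[C]_m), and A ^t* is the adjoint of A. *)

Section Channels.
Variable C : numClosedFieldType.

(* [0 <= z] in C means that z is real and nonnegative. *)
Definition psdmx n (A : 'M[C]_n) : Prop :=
  A ^t* = A /\ forall x : 'cV[C]_n, 0 <= (x ^t* *m A *m x) 0 0.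

(* C^n (x) C^q is C^(n * q), with the basis ordering of the Kronecker product
   [tensmx]; tens_block Z s t is the n x n matrix Z_(s,t) in the decomposition
   Z = \sum_(s, t) Z_(s,t) (x) E_(s,t). *)
Definition tens_block n q (Z : 'M[C]_(n * q)) (s t : 'I_q) : 'M[C]_n :=
  \matrix_(i, j) Z (mxtens_index (i, s)) (mxtens_index (j, t)).

(* Phi (x) id_q; see [ampliation_tens]. *)
Definition ampliation n m (Phi : 'Hom('M[C]_n, 'M[C]_m)) q
    (Z : 'M[C]_(n * q)) : 'M[C]_(m * q) :=
  \sum_(s < q) \sum_(t < q) tensmx (Phi (tens_block Z s t)) (delta_mx s t).

Definition completely_positive n m (Phi : 'Hom('M[C]_n, 'M[C]_m)) : Prop :=
  forall q, (0 < q)%N ->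
  forall Z : 'M[C]_(n * q), psdmx Z -> psdmx (ampliation Phi Z).

Definition trace_preserving n m (Phi : 'Hom('M[C]_n, 'M[C]_m)) : Prop :=
  forall X : 'M[C]_n, \tr (Phi X) = \tr X.

Definition CPTP n m (Phi : 'Hom('M[C]_n, 'M[C]_m)) : Prop :=
  completely_positive Phi /\ trace_preserving Phi.

Definition CPTP_invertible n (Phi : 'End('M[C]_n)) : Prop :=
  CPTP Phi /\ exists Psi : 'End('M[C]_n),
    [/\ CPTP Psi, (Psi \o Phi)%VF = \1%VF & (Phi \o Psi)%VF = \1%VF].

Lemma ampliationE n m (Phi : 'Hom('M[C]_n, 'M[C]_m)) q (Z : 'M[C]_(n * q))
    i j s t :
  ampliation Phi Z (mxtens_index (i, s)) (mxtens_index (j, t)) =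
  Phi (tens_block Z s t) i j.
Proof.
rewrite /ampliation summxE (bigD1 s) //= summxE (bigD1 t) //= tensmxE.
rewrite mxE !eqxx mulr1 big1 ?addr0 => [|t' /negPf t't]; last first.
  by rewrite tensmxE mxE [t == _]eq_sym t't andbF mulr0.
rewrite big1 ?addr0 // => s' /negPf s's.
by rewrite summxE big1 // => t' _; rewrite tensmxE mxE [s == _]eq_sym s's mulr0.
Qed.

Lemma ampliation_linear n m (Phi : 'Hom('M[C]_n, 'M[C]_m)) q :
  linear (ampliation Phi (q := q)).
Proof.
move=> a Z W; apply/matrixP => k l.
case: (mxtens_indexP k) => i s; case: (mxtens_indexP l) => j t.
rewrite ampliationE [RHS]mxE [in RHS]mxE !ampliationE.
have -> : tens_block (a *: Z + W) s t =
          a *: tens_block Z s t + tens_block W s t.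
  by apply/matrixP => ? ?; rewrite !mxE.
by rewrite linearP !mxE.
Qed.

Lemma ampliation_tens n m (Phi : 'Hom('M[C]_n, 'M[C]_m)) q X (Y : 'M[C]_q) :
  ampliation Phi (tensmx X Y) = tensmx (Phi X) Y.
Proof.
apply/matrixP => k l.
case: (mxtens_indexP k) => i s; case: (mxtens_indexP l) => j t.
rewrite ampliationE tensmxE.
have -> : tens_block (tensmx X Y) s t = Y s t *: X.
  by apply/matrixP => ? ?; rewrite mxE tensmxE mxE mulrC.
by rewrite linearZ mxE mulrC.
Qed.

Lemma ampliation1 n q (Z : 'M[C]_(n * q)) : ampliation \1%VF Z = Z.
Proof.
apply/matrixP => k l.
case: (mxtens_indexP k) => i s; case: (mxtens_indexP l) => j t.
by rewrite ampliationE lfunE /= mxE.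
Qed.

Lemma ampliation_comp n m p (Phi : 'Hom('M[C]_m, 'M[C]_p))
    (Psi : 'Hom('M[C]_n, 'M[C]_m)) q (Z : 'M[C]_(n * q)) :
  ampliation (Phi \o Psi)%VF Z = ampliation Phi (ampliation Psi Z).
Proof.
apply/matrixP => k l.
case: (mxtens_indexP k) => i s; case: (mxtens_indexP l) => j t.
rewrite !ampliationE lfunE /=; congr (Phi _ i j).
by apply/matrixP => i' j'; rewrite [RHS]mxE ampliationE.
Qed.

Lemma CPTP1 n : CPTP (\1%VF : 'End('M[C]_n)).
Proof.
by split=> [q _ Z|X]; [rewrite ampliation1 | rewrite lfunE].
Qed.

Lemma CPTP_comp n m p (Phi : 'Hom('M[C]_m, 'M[C]_p))
    (Psi : 'Hom('M[C]_n, 'M[C]_m)) :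
  CPTP Phi -> CPTP Psi -> CPTP (Phi \o Psi)%VF.
Proof.
move=> [cpPhi tpPhi] [cpPsi tpPsi]; split=> [q q0 Z psdZ|X].
  by rewrite ampliation_comp; apply: cpPhi => //; apply: cpPsi.
by rewrite lfunE /= tpPhi tpPsi.
Qed.

Lemma CPTP_invertible1 n : CPTP_invertible (\1%VF : 'End('M[C]_n)).
Proof.
split; first exact: CPTP1.
by exists \1%VF; split; [exact: CPTP1 | rewrite comp_lfun1l..].
Qed.

Lemma CPTP_invertible_comp n (Phi Psi : 'End('M[C]_n)) :
  CPTP_invertible Phi -> CPTP_invertible Psi ->
  CPTP_invertible (Phi \o Psi)%VF.
Proof.
move=> [cPhi [Phi' [cPhi' Phi'K PhiK]]] [cPsi [Psi' [cPsi' Psi'K PsiK]]].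
split; first exact: CPTP_comp.
exists (Psi' \o Phi')%VF; split; first exact: CPTP_comp.
  by rewrite comp_lfunA -(comp_lfunA Psi') Phi'K comp_lfun1r.
by rewrite comp_lfunA -(comp_lfunA Phi) PsiK comp_lfun1r.
Qed.

Lemma CPTP_invertible_ker n (Phi : 'End('M[C]_n)) :
  CPTP_invertible Phi -> lker Phi == 0%VS.
Proof.
move=> [_ [Psi [_ PsiK _]]]; apply/lker0P => X Y eqXY.
have K Z : Psi (Phi Z) = Z by rewrite -[RHS](id_lfunE Z) -PsiK lfunE.
by rewrite -[X]K eqXY K.
Qed.

Lemma CPTP_invertible_inv n (Phi : 'End('M[C]_n)) :
  CPTP_invertible Phi -> CPTP_invertible (Phi^-1)%VF.
Proof.
move=> iPhi; have k0 := CPTP_invertible_ker iPhi.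
case: iPhi => [cPhi [Psi [cPsi PsiK PhiK]]].
have -> : (Phi^-1)%VF = Psi.
  by rewrite -[LHS]comp_lfun1r -PhiK comp_lfunA lker0_compVf // comp_lfun1l.
by split=> //; exists Phi.
Qed.

(* The group of CPTP maps with CPTP inverse, under composition. *)
Record CPTP_group n := CPTPGroup {
  CPTP_map :> 'End('M[C]_n);
  CPTP_mapP : `[< CPTP_invertible CPTP_map >] }.

HB.instance Definition _ n := [isSub for @CPTP_map n].
HB.instance Definition _ n := [Choice of CPTP_group n by <:].

Definition CPTP_one n : CPTP_group n :=
  CPTPGroup (asboolT (CPTP_invertible1 n)).

Definition CPTP_mul n (x y : CPTP_group n) : CPTP_group n :=
  @CPTPGroup n (x \o y)%VF (asboolT
    (CPTP_invertible_comp (asboolW (CPTP_mapP x)) (asboolW (CPTP_mapP y)))).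

Definition CPTP_inv n (x : CPTP_group n) : CPTP_group n :=
  @CPTPGroup n (x^-1)%VF (asboolT (CPTP_invertible_inv (asboolW (CPTP_mapP x)))).

Lemma CPTP_mulA n : associative (@CPTP_mul n).
Proof. by move=> x y z; apply: val_inj; rewrite /= comp_lfunA. Qed.

Lemma CPTP_mul1g n : left_id (@CPTP_one n) (@CPTP_mul n).
Proof. by move=> x; apply: val_inj; rewrite /= comp_lfun1l. Qed.

Lemma CPTP_mulg1 n : right_id (@CPTP_one n) (@CPTP_mul n).
Proof. by move=> x; apply: val_inj; rewrite /= comp_lfun1r. Qed.

Lemma CPTP_mulVg n : left_inverse (@CPTP_one n) (@CPTP_inv n) (@CPTP_mul n).
Proof.
move=> x; apply: val_inj => /=; apply: lker0_compVf.
exact: CPTP_invertible_ker (asboolW (CPTP_mapP x)).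
Qed.

Lemma CPTP_mulgV n : right_inverse (@CPTP_one n) (@CPTP_inv n) (@CPTP_mul n).
Proof.
move=> x; apply: val_inj => /=; apply: lker0_compfV.
exact: CPTP_invertible_ker (asboolW (CPTP_mapP x)).
Qed.

HB.instance Definition _ n := isGroup.Build (CPTP_group n)
  (@CPTP_mulA n) (@CPTP_mul1g n) (@CPTP_mulg1 n) (@CPTP_mulVg n)
  (@CPTP_mulgV n).

Definition special_unitary n (U : 'M[C]_n) : bool :=
  (U \is unitarymx) && (\det U == 1).

(* The map Phi is X |-> U X U^*. *)
Definition conjugation_by n (U : 'M[C]_n) (Phi : 'End('M[C]_n)) : Prop :=
  forall X : 'M[C]_n, Phi X = U *m X *m U ^t*.

End Channels.

Section SpecialOrthogonal.
Variables (F : fieldType) (n : nat).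

Definition special_orthogonal (A : 'M[F]_n) : bool :=
  (A *m A^T == 1%:M) && (\det A == 1).

Record SO_group := SOGroup {
  SO_mx :> 'M[F]_n;
  SO_mxP : special_orthogonal SO_mx }.

HB.instance Definition _ := [isSub for SO_mx].
HB.instance Definition _ := [Choice of SO_group by <:].

Lemma special_orthogonal1 : special_orthogonal 1%:M.
Proof. by rewrite /special_orthogonal trmx1 mulmx1 det1 !eqxx. Qed.

Lemma special_orthogonalM A B :
  special_orthogonal A -> special_orthogonal B -> special_orthogonal (A *m B).
Proof.
move=> /andP[/eqP oA /eqP dA] /andP[/eqP oB /eqP dB].
rewrite /special_orthogonal trmx_mul mulmxA -(mulmxA A) oB mulmx1 oA.
by rewrite det_mulmx dA dB mulr1 !eqxx.
Qed.

Lemma special_orthogonalV A : special_orthogonal A -> special_orthogonal A^T.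
Proof.
move=> /andP[/eqP oA dA].
by rewrite /special_orthogonal trmxK det_tr dA (mulmx1C oA) eqxx.
Qed.

Definition SO_one : SO_group := SOGroup special_orthogonal1.

Definition SO_mul (A B : SO_group) : SO_group :=
  @SOGroup (A *m B) (special_orthogonalM (SO_mxP A) (SO_mxP B)).

Definition SO_inv (A : SO_group) : SO_group :=
  @SOGroup A^T (special_orthogonalV (SO_mxP A)).

Lemma SO_mulA : associative SO_mul.
Proof. by move=> x y z; apply: val_inj; rewrite /= mulmxA. Qed.

Lemma SO_mul1g : left_id SO_one SO_mul.
Proof. by move=> x; apply: val_inj; rewrite /= mul1mx. Qed.

Lemma SO_mulg1 : right_id SO_one SO_mul.
Proof. by move=> x; apply: val_inj; rewrite /= mulmx1. Qed.

Lemma SO_mulgV : right_inverse SO_one SO_inv SO_mul.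
Proof.
by move=> x; apply: val_inj => /=; have /andP[/eqP-> _] := SO_mxP x.
Qed.

Lemma SO_mulVg : left_inverse SO_one SO_inv SO_mul.
Proof.
move=> x; apply: val_inj => /=; apply: mulmx1C.
by have /andP[/eqP-> _] := SO_mxP x.
Qed.

HB.instance Definition _ := isGroup.Build SO_group
  SO_mulA SO_mul1g SO_mulg1 SO_mulVg SO_mulgV.

End SpecialOrthogonal.

Section Pauli.
Variable R : realType.

(* The Pauli matrices, indexed from 0:
   [0 1; 1 0], [0 -i; i 0], [1 0; 0 -1]. *)
Definition pauli (k : 'I_3) : 'M[R[i]]_2 :=
  tnth [tuple delta_mx 0 1 + delta_mx 1 0;
              'i%C *: (delta_mx 1 0 - delta_mx 0 1);
              delta_mx 0 0 - delta_mx 1 1] k.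

(* The entries are traces, hence a priori complex; k is the row index. *)
Definition pauli_rotation (U : 'M[R[i]]_2) : 'M[R[i]]_3 :=
  \matrix_(k, j) (2^-1 * \tr (U *m pauli j *m U ^t* *m pauli k)).

End Pauli.

(* Main.v *)
Require Import Defs.
From mathcomp Require Import all_boot all_order all_algebra.
From mathcomp Require Import sesquilinear spectral.
From mathcomp Require Import boolp reals.
From mathcomp.real_closed Require Import mxtens.
From mathcomp Require Import ring.
Set Implicit Arguments.
Unset Strict Implicit.
Unset Printing Implicit Defensive.
Import Order.TTheory GRing.Theory Num.Theory.
Local Open Scope ring_scope.
Local Open Scope sesquilinear_scope.

(* If K_i and L_j are Kraus operators of Phi and of its inverse, the products
   L_j K_i are Kraus operators of the identity, hence scalar. One of them is
   nonzero, which makes all K_i proportional to one invertible matrix, so that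
   Phi is a conjugation X |-> U X U^*, with U unitary by trace preservation.

   Writing T_j = \sum_k A_(k,j) sigma_k, a Gram matrix A^T A = 1 makes the T_j
   anticommuting involutions with T_0 T_1 T_2 = i det A. For A = R(U) this
   product is U (sigma_0 sigma_1 sigma_2) U^* = i, whence det R(U) = 1.
   Conversely, for A in SO(3) the T_j satisfy the relations of the Pauli
   matrices, and a unitary intertwiner is built from an eigenvector of T_2. *)

(** * Adjoints and positive semidefinite matrices *)

Lemma adjmxM (C : numClosedFieldType) m n p (A : 'M[C]_(m, n))
    (B : 'M[C]_(n, p)) : (A *m B)^t* = B^t* *m A^t*.
Proof. by rewrite trmx_mul map_mxM. Qed.

Lemma adjmxZ (C : numClosedFieldType) m n a (A : 'M[C]_(m, n)) :
  (a *: A)^t* = a^* *: A^t*.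
Proof. by apply/matrixP => i j; rewrite !mxE rmorphM. Qed.

Lemma adjmx_sum (C : numClosedFieldType) m n (I : finType)
    (F : I -> 'M[C]_(m, n)) : (\sum_i F i)^t* = \sum_i (F i)^t*.
Proof. by rewrite !raddf_sum. Qed.

Lemma adjmx_delta (C : numClosedFieldType) m n (i : 'I_m) (j : 'I_n) :
  (delta_mx i j : 'M[C]_(m, n))^t* = delta_mx j i.
Proof. by rewrite trmx_delta map_delta_mx. Qed.

Lemma mulmx_adj_ge0 (C : numClosedFieldType) n (y : 'cV[C]_n) :
  0 <= (y^t* *m y) 0 0.
Proof. by rewrite mxE sumr_ge0 // => i _; rewrite !mxE mulrC mul_conjC_ge0. Qed.

Lemma mulmx_adj_eq0 (C : numClosedFieldType) n (y : 'cV[C]_n) :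
  (y^t* *m y) 0 0 = 0 -> y = 0.
Proof.
rewrite mxE => /eqP; rewrite psumr_eq0 => [/allP y0|i _]; last first.
  by rewrite !mxE mulrC mul_conjC_ge0.
apply/matrixP => i j; rewrite ord1 [RHS]mxE.
have /implyP/(_ isT) := y0 i (mem_index_enum i).
by rewrite !mxE mulrC mul_conjC_eq0 => /eqP.
Qed.

Lemma psdmx_rank1 (C : numClosedFieldType) n (w : 'cV[C]_n) :
  psdmx (w *m w^t*).
Proof.
split=> [|x]; first by rewrite adjmxM trmxCK.
have := mulmx_adj_ge0 (w^t* *m x).
by rewrite adjmxM trmxCK !mulmxA.
Qed.

(** Spectral theorem: the v_k are orthogonal eigenvectors scaled by square roots of eigenvalues,
    which are nonnegative as values of the quadratic form at unit eigenvectors. *)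
Lemma psdmx_sum_rank1 (C : numClosedFieldType) n (A : 'M[C]_n) :
  psdmx A -> exists v : 'I_n -> 'cV[C]_n, A = \sum_k v k *m (v k)^t*.
Proof.
move=> [adjA psdA].
have /orthomx_spectralP : A \is normalmx by apply/normalmxP; rewrite adjA.
have := spectral_unitarymx A.
move: (spectralmx A) (spectral_diag A) => P d uP.
rewrite invmx_unitary // => eqA.
have /unitarymxP PP := uP.
have d_ge0 k : 0 <= d 0 k.
  have := psdA (P^t* *m delta_mx k 0).
  rewrite eqA adjmxM trmxCK adjmx_delta !mulmxA.
  by rewrite -!(mulmxA _ P) PP !mulmx1 -rowE -colE !mxE eqxx mulr1n.
exists (fun k => sqrtC (d 0 k) *: (P^t* *m delta_mx k 0)).
rewrite {1}eqA diag_mx_sum_delta mulmx_sumr mulmx_suml.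
apply: eq_bigr => k _.
rewrite adjmxZ adjmxM trmxCK adjmx_delta -[LHS]mulmxA -!scalemxAl -!scalemxAr.
rewrite scalerA geC0_conj ?sqrtC_ge0 // -expr2 sqrtCK.
by rewrite -mulmxA (mulmxA (delta_mx k 0)) mul_delta_mx.
Qed.

(** * Choi matrices and Kraus operators *)

Lemma kraus_entry (C : numClosedFieldType) m n (I : finType)
    (K : I -> 'M[C]_(m, n)) s t i j :
  (\sum_k K k *m delta_mx s t *m (K k)^t*) i j =
  \sum_k K k i s * (K k j t)^*.
Proof.
rewrite summxE; apply: eq_bigr => k _.
rewrite -(mul_delta_mx (0 : 'I_1)) mulmxA -colE -mulmxA -rowE.
by rewrite mxE big_ord1 !mxE.
Qed.

(* The vector of the unnormalised maximally entangled state: its rank-one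
   projector has the matrix units as blocks. *)
Definition entangled_vector (C : numClosedFieldType) n : 'cV[C]_(n * n) :=
  \col_k ((mxtens_unindex k).1 == (mxtens_unindex k).2)%:R.

Lemma tens_block_entangled (C : numClosedFieldType) n (s t : 'I_n) :
  tens_block (entangled_vector C n *m (entangled_vector C n)^t*) s t =
  delta_mx s t.
Proof.
apply/matrixP => i j; rewrite !mxE big_ord1 !mxE !mxtens_indexK /=.
by rewrite rmorph_nat -natrM mulnb.
Qed.

(** Choi's argument: the ampliation of the entangled projector is positive semidefinite, hence a sum
    of rank-one terms, and each of their vectors reshapes into a Kraus operator. Both sides then
    agree on matrix units, so everywhere by linearity. *)
Lemma kraus_decomposition (C : numClosedFieldType) n m
    (Phi : 'Hom('M[C]_n, 'M[C]_m)) :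
  completely_positive Phi ->
  exists K : 'I_(m * n) -> 'M[C]_(m, n),
    forall X, Phi X = \sum_k K k *m X *m (K k)^t*.
Proof.
(* The ancilla will have dimension n, and complete positivity speaks only of positive dimensions. *)
move=> cpPhi; have [n0|n_gt0] := posnP n.
  subst n; exists (fun=> 0) => X.
  by rewrite (flatmx0 X) linear0 big1 // => k _; rewrite mulmx0 mul0mx.
have [v choi] :=
  psdmx_sum_rank1 (cpPhi n n_gt0 _ (psdmx_rank1 (entangled_vector C n))).
pose K k : 'M_(m, n) := \matrix_(i, s) v k (mxtens_index (i, s)) 0.
exists K => X.
have KX k : K k *m X *m (K k)^t* =
    \sum_s \sum_t X s t *: (K k *m delta_mx s t *m (K k)^t*).
  rewrite {1}(matrix_sum_delta X) mulmx_sumr mulmx_suml.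
  apply: eq_bigr => s _; rewrite mulmx_sumr mulmx_suml.
  by apply: eq_bigr => t _; rewrite -scalemxAr -scalemxAl.
under [RHS]eq_bigr => k _ do rewrite KX.
rewrite {1}(matrix_sum_delta X).
rewrite linear_sum [RHS]exchange_big; apply: eq_bigr => s _ /=.
rewrite linear_sum [RHS]exchange_big; apply: eq_bigr => t _ /=.
rewrite linearZ -scaler_sumr; congr (_ *: _).
apply/matrixP => i j.
rewrite kraus_entry -tens_block_entangled -ampliationE choi summxE.
by apply: eq_bigr => k _; rewrite !mxE big_ord1 !mxE.
Qed.

(** View each entry position (i, s) as the vector of the values M_k i s over k. Evaluating at matrix
    units gives the Gram matrix of these vectors: off-diagonal positions have norm 0, and so does
    the difference of two diagonal ones, since 1 - 1 - 1 + 1 = 0. *)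
Lemma kraus_id_scalar (C : numClosedFieldType) n (I : finType)
    (M : I -> 'M[C]_n) :
  (forall X, \sum_k M k *m X *m (M k)^t* = X) ->
  forall k, exists c, M k = c%:M.
Proof.
move=> MX; case: n M MX => [|n] M MX k.
  by exists 0; apply/matrixP => -[].
have E s t i j : \sum_k M k i s * (M k j t)^* = ((i == s) && (j == t))%:R.
  by rewrite -kraus_entry MX mxE.
have diff0 (a : I -> C) : \sum_k a k * (a k)^* = 0 -> a k = 0.
  move/eqP; rewrite psumr_eq0 => [/allP a0|l _]; last exact: mul_conjC_ge0.
  have /implyP/(_ isT) := a0 k (mem_index_enum k).
  by rewrite mul_conjC_eq0 => /eqP.
exists (M k 0 0); apply/matrixP => i j; rewrite mxE.
have [<-{j}|ij] := eqVneq i j; last first.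
  by apply: (diff0 (fun l => M l i j)); rewrite E (negPf ij).
rewrite mulr1n; apply/eqP; rewrite -subr_eq0; apply/eqP.
apply: (diff0 (fun l => M l i i - M l 0 0)).
under eq_bigr => l _ do rewrite rmorphB mulrBl !mulrBr.
by rewrite !sumrB !E !eqxx subrr.
Qed.

(** * Reversible channels are conjugations by special unitaries *)

Lemma CPTP_invertible_unitary (C : numClosedFieldType) n
    (Phi : 'End('M[C]_n)) : CPTP_invertible Phi ->
  exists U : 'M[C]_n, U \is unitarymx /\ conjugation_by U Phi.
Proof.
case: n Phi => [|n] Phi.
  exists 1%:M; split; first by apply/unitarymxP/matrixP => -[].
  by move=> X; apply/matrixP => -[].
move=> [[cpPhi tpPhi] [Psi [[cpPsi tpPsi] PsiK _]]].
have [K PhiE] := kraus_decomposition cpPhi.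
have [L PsiE] := kraus_decomposition cpPsi.
have LKX X : \sum_p (L p.1 *m K p.2) *m X *m (L p.1 *m K p.2)^t* = X.
  rewrite -(pair_bigA _ (fun j i => L j *m K i *m X *m (L j *m K i)^t*)) /=.
  have : Psi (Phi X) = X by rewrite -[RHS](id_lfunE X) -PsiK lfunE.
  rewrite PhiE PsiE => {2}<-; apply: eq_bigr => j _.
  rewrite mulmx_sumr mulmx_suml; apply: eq_bigr => i _.
  by rewrite adjmxM !mulmxA.
have LK j i : exists c, L j *m K i = c%:M := kraus_id_scalar LKX (j, i).
have [[j i] LK0] : exists p, L p.1 *m K p.2 != 0.
  apply/existsP; apply: contraT; rewrite negb_exists => /forallP LK0.
  have := LKX 1%:M; rewrite big1 => [/esym/eqP|p _]; first by rewrite oner_eq0.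
  by have := LK0 p; rewrite negbK => /eqP->; rewrite !mul0mx.
rewrite /= in LK0; have [c LKc] := LK j i.
have c0 : c != 0 by apply: contraNneq LK0 => c0; rewrite LKc c0 raddf0.
(* A one-sided inverse of a square matrix is two-sided, so K_l = K_i (c^-1 L_j) K_l, where L_j K_l
   is scalar. *)
have BK : (c^-1 *: L j) *m K i = 1%:M.
  by rewrite -scalemxAl LKc scale_scalar_mx mulVf.
have KB := mulmx1C BK.
have aK l : exists b, K l = b *: K i.
  have [b LKb] := LK j l; exists (c^-1 * b).
  rewrite -[LHS]mul1mx -KB -mulmxA -scalemxAl LKb scale_scalar_mx.
  by rewrite mul_mx_scalar.
have [a Ka] := choice aK.
have g_ge0 : 0 <= \sum_l a l * (a l)^*.
  by rewrite sumr_ge0 // => l _; rewrite mul_conjC_ge0.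
(* With K_l = a_l K_i, the Kraus sum collapses to g K_i X K_i^*, and the square root of g is
   absorbed into K_i. *)
set g := \sum_l _ in g_ge0; exists (sqrtC g *: K i).
have UPhi : conjugation_by (sqrtC g *: K i) Phi.
  move=> X; rewrite PhiE adjmxZ geC0_conj ?sqrtC_ge0 // -!scalemxAl -scalemxAr.
  rewrite scalerA -expr2 sqrtCK scaler_suml; apply: eq_bigr => l _.
  by rewrite Ka adjmxZ -!scalemxAl -scalemxAr scalerA.
split=> //; move: (_ *: K i) UPhi => U UPhi.
(* Pairing with matrix units under the trace recovers the entries of U^* U. *)
apply/unitarymxP/mulmx1C/matrixP => s t.
have := tpPhi (delta_mx t s); rewrite UPhi.
have tr_delta (B : 'M[C]_n.+1) : \tr (B *m delta_mx t s) = B s t.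
  rewrite -(mul_delta_mx (0 : 'I_1)) mulmxA mxtrace_mulC mulmxA -rowE -colE.
  by rewrite /mxtrace big_ord1 !mxE.
by rewrite mxtrace_mulC mulmxA tr_delta -[delta_mx t s]mul1mx tr_delta.
Qed.

(** Dividing U by an n-th root of its determinant makes the determinant 1. The root has modulus 1,
    so it cancels against its conjugate in the conjugation. *)
Lemma special_unitary_normalize (C : numClosedFieldType) n (U : 'M[C]_n) :
  U \is unitarymx -> exists V : 'M[C]_n,
    special_unitary V /\ forall X, V *m X *m V^t* = U *m X *m U^t*.
Proof.
move=> uU; have [n0|n_gt0] := posnP n.
  by subst n; exists U; rewrite /special_unitary uU det_mx00 eqxx.
have /unitarymxP UU := uU.
set z := n.-root (\det U).
have zn : z ^+ n = \det U by rewrite rootCK.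
have normz : `|z| = 1.
  apply/eqP; rewrite -(@pexpr_eq1 _ _ n) // -normrX zn.
  rewrite -(@pexpr_eq1 _ _ 2) // normCK.
  by rewrite -det_map_mx -[X in _ * X]det_tr map_trmx -det_mulmx UU det1.
have z0 : z != 0 by rewrite -normr_eq0 normz oner_eq0.
have zz : z^-1 * (z^-1)^* = 1 by rewrite -normCK normfV normz invr1 expr1n.
have conjV X : (z^-1 *: U) *m X *m (z^-1 *: U)^t* = U *m X *m U^t*.
  by rewrite adjmxZ -!scalemxAl -scalemxAr scalerA zz scale1r.
exists (z^-1 *: U); split=> //; apply/andP; split; last first.
  by rewrite detZ exprVn zn mulVf // -zn expf_neq0.
by apply/unitarymxP; have := conjV 1%:M; rewrite !mulmx1 UU.
Qed.

(** * Unitary conjugations are reversible channels *)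

Definition conj_channel (C : numClosedFieldType) n (U : 'M[C]_n) :
  'End('M[C]_n) := linfun (mulmxr (U^t*) \o mulmx U).

Lemma conj_channelE (C : numClosedFieldType) n (U : 'M[C]_n) :
  conjugation_by U (conj_channel U).
Proof. by move=> X; rewrite lfunE. Qed.

Lemma psdmx_conj (C : numClosedFieldType) n (W Z : 'M[C]_n) :
  psdmx Z -> psdmx (W *m Z *m W^t*).
Proof.
move=> [adjZ psdZ]; split=> [|x]; first by rewrite !adjmxM trmxCK adjZ mulmxA.
by have := psdZ (W^t* *m x); rewrite adjmxM trmxCK !mulmxA.
Qed.

(** Reduces complete positivity of a conjugation to the fact that a single conjugation preserves
    positivity. *)
Lemma ampliation_conj_channel (C : numClosedFieldType) n (U : 'M[C]_n) q
    (Z : 'M[C]_(n * q)) :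
  ampliation (conj_channel U) Z =
  tensmx U 1%:M *m Z *m (tensmx U 1%:M)^t*.
Proof.
(* The ampliation of the identity expands Z into its blocks tensored with matrix units. *)
rewrite -[X in _ *m X *m _]ampliation1 /ampliation mulmx_sumr mulmx_suml.
apply: eq_bigr => s _; rewrite mulmx_sumr mulmx_suml.
apply: eq_bigr => t _; rewrite trmx_tens map_mxT !tensmx_mul.
by rewrite trmx1 map_mx1 mulmx1 mul1mx conj_channelE id_lfunE.
Qed.

Lemma CPTP_conj_channel (C : numClosedFieldType) n (U : 'M[C]_n) :
  U \is unitarymx -> CPTP (conj_channel U).
Proof.
move=> /unitarymxP/mulmx1C UU; split=> [q _ Z psdZ|X].
  by rewrite ampliation_conj_channel; apply: psdmx_conj.
by rewrite conj_channelE mxtrace_mulC mulmxA UU mul1mx.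
Qed.

Lemma CPTP_invertible_conj_channel (C : numClosedFieldType) n (U : 'M[C]_n) :
  U \is unitarymx -> CPTP_invertible (conj_channel U).
Proof.
move=> uU; have /unitarymxP UU := uU; have UU' := mulmx1C UU.
split; first exact: CPTP_conj_channel.
exists (conj_channel (U^t*)); split.
- by apply: CPTP_conj_channel; rewrite trmxC_unitary.
- apply/lfunP => X; rewrite lfunE /= !conj_channelE id_lfunE trmxCK.
  by rewrite !mulmxA UU' mul1mx -mulmxA UU' mulmx1.
- apply/lfunP => X; rewrite lfunE /= !conj_channelE id_lfunE trmxCK.
  by rewrite !mulmxA UU mul1mx -mulmxA UU mulmx1.
Qed.

(** * Sums, matrices and determinants in dimensions 2 and 3 *)

Lemma big_ord3 (V : nmodType) (F : 'I_3 -> V) :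
  \sum_i F i = F 0 + F 1 + F 2.
Proof.
rewrite !big_ord_recl big_ord0 addr0 addrA.
by congr (_ + F _ + F _); apply: val_inj.
Qed.

Lemma big_ord2 (V : nmodType) (F : 'I_2 -> V) : \sum_i F i = F 0 + F 1.
Proof.
rewrite !big_ord_recl big_ord0 addr0.
by congr (_ + F _); apply: val_inj.
Qed.

Lemma ord3P (P : 'I_3 -> Prop) : P 0 -> P 1 -> P 2 -> forall k, P k.
Proof.
move=> P0 P1 P2 [[|[|[|//]]] k3].
- by rewrite (_ : Ordinal k3 = 0) //; apply: val_inj.
- by rewrite (_ : Ordinal k3 = 1) //; apply: val_inj.
- by rewrite (_ : Ordinal k3 = 2) //; apply: val_inj.
Qed.

Lemma ord2P (P : 'I_2 -> Prop) : P 0 -> P 1 -> forall k, P k.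
Proof.
move=> P0 P1 [[|[|//]] k2].
- by rewrite (_ : Ordinal k2 = 0) //; apply: val_inj.
- by rewrite (_ : Ordinal k2 = 1) //; apply: val_inj.
Qed.

Lemma matrix2P (T : Type) (A B : 'M[T]_2) :
  A 0 0 = B 0 0 -> A 0 1 = B 0 1 -> A 1 0 = B 1 0 -> A 1 1 = B 1 1 -> A = B.
Proof. by move=> *; apply/matrixP; apply: ord2P; apply: ord2P. Qed.

Lemma det_mx33 (K : comNzRingType) (A : 'M[K]_3) :
  \det A = A 0 0 * (A 1 1 * A 2 2 - A 1 2 * A 2 1)
         - A 0 1 * (A 1 0 * A 2 2 - A 1 2 * A 2 0)
         + A 0 2 * (A 1 0 * A 2 1 - A 1 1 * A 2 0).
Proof.
(* Indexing entries by natural numbers lets the lifted indices of the cofactor expansion reduce to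
   numerals, so that [ring] identifies equal entries. *)
pose a i j := A (inord i) (inord j).
have aE i j : A i j = a i j by rewrite /a !inord_val.
rewrite (expand_det_row _ 0) big_ord3 /cofactor.
rewrite !(expand_det_row _ 0) !big_ord2 /cofactor !det_mx11 !mxE !aE /=.
rewrite /bump /=; ring.
Qed.

(** * Algebra of combinations of Pauli matrices *)

Lemma conjC_i (R : realType) : ('i%C : R[i])^* = - 'i%C.
Proof. by apply/eqP; rewrite eq_complex /= oppr0 !eqxx. Qed.

Lemma pauli_entries (R : realType) (k : 'I_3) :
  (pauli R k 0 0 = (k == 2)%:R) *
  (pauli R k 0 1 = (k == 0)%:R - 'i%C * (k == 1)%:R) *
  (pauli R k 1 0 = (k == 0)%:R + 'i%C * (k == 1)%:R) *
  (pauli R k 1 1 = - (k == 2)%:R).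
Proof.
move: k; apply: ord3P; rewrite /pauli /tnth /= !mxE /=; do !split; ring.
Qed.

(** The coefficients are complex so that the frame of [pauli_rotation U] makes sense before its
    entries are known to be real. *)
Definition pauli_frame (R : realType) (A : 'M[R[i]]_3) (j : 'I_3) :
  'M[R[i]]_2 := \sum_k A k j *: pauli R k.

Lemma pauli_frame_entries (R : realType) (A : 'M[R[i]]_3) j :
  (pauli_frame A j 0 0 = A 2 j) *
  (pauli_frame A j 0 1 = A 0 j - 'i%C * A 1 j) *
  (pauli_frame A j 1 0 = A 0 j + 'i%C * A 1 j) *
  (pauli_frame A j 1 1 = - A 2 j).
Proof.
have E a b : pauli_frame A j a b = \sum_k A k j * pauli R k a b.
  by rewrite summxE; apply: eq_bigr => k _; rewrite mxE.
by rewrite !E !big_ord3 !pauli_entries /=; do !split; ring.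
Qed.

Lemma pauli_frame1 (R : realType) j : pauli_frame 1%:M j = pauli R j.
Proof.
rewrite /pauli_frame (bigD1 j) //= mxE eqxx scale1r big1 ?addr0 // => k.
by rewrite mxE => /negPf->; rewrite scale0r.
Qed.

Lemma mxtrace2 (K : pzSemiRingType) (A : 'M[K]_2) : \tr A = A 0 0 + A 1 1.
Proof. by rewrite /mxtrace big_ord2. Qed.

Lemma mulmx2 (K : pzSemiRingType) m n (A : 'M[K]_(m, 2))
    (B : 'M[K]_(2, n)) i j :
  (A *m B) i j = A i 0 * B 0 j + A i 1 * B 1 j.
Proof. by rewrite mxE big_ord2. Qed.

Lemma mxtrace_pauli_frame (R : realType) (A : 'M[R[i]]_3) j k :
  \tr (pauli_frame A j *m pauli R k) = 2 * A k j.
Proof.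
have ii : 'i%C ^+ 2 = -1 :> R[i] by exact: sqr_i.
rewrite mxtrace2 !mulmx2 !pauli_frame_entries !pauli_entries.
by move: k; apply: ord3P => /=; ring: ii.
Qed.

(** The Pauli matrices form a basis of the traceless matrices, orthogonal for the trace form with
    squared norm 2. All columns of the coefficient matrix are equal, so any j serves. *)
Lemma pauli_frame_trace0 (R : realType) (X : 'M[R[i]]_2) j : \tr X = 0 ->
  X = pauli_frame (\matrix_(k, _) (2^-1 * \tr (X *m pauli R k))) j.
Proof.
have ii : 'i%C ^+ 2 = -1 :> R[i] by exact: sqr_i.
rewrite mxtrace2 => /eqP; rewrite addr_eq0 => /eqP X00.
apply: matrix2P; rewrite pauli_frame_entries !mxE !mxtrace2 !mulmx2;
  rewrite !pauli_entries /= X00; by field: ii.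
Qed.

Lemma pauli_frame_anticomm (R : realType) (A : 'M[R[i]]_3) j l :
  pauli_frame A j *m pauli_frame A l + pauli_frame A l *m pauli_frame A j =
  (2 * (A^T *m A) j l)%:M.
Proof.
have ii : 'i%C ^+ 2 = -1 :> R[i] by exact: sqr_i.
have -> : (A^T *m A) j l = A 0 j * A 0 l + A 1 j * A 1 l + A 2 j * A 2 l.
  by rewrite mxE big_ord3 !mxE.
by apply: matrix2P; rewrite mxE !mulmx2 !pauli_frame_entries mxE /=; ring: ii.
Qed.

(** Product of three vectors in a Clifford algebra: the triple product gives the scalar part, and
    the vector part vanishes when the vectors are orthogonal. *)
Lemma pauli_frame_mul3 (R : realType) (A : 'M[R[i]]_3) :
  let T := pauli_frame A in let G := A^T *m A in
  T 0 *m T 1 *m T 2 =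
  ('i%C * \det A)%:M + (G 0 1 *: T 2 - G 0 2 *: T 1 + G 1 2 *: T 0).
Proof.
move=> T G.
have ii : 'i%C ^+ 2 = -1 :> R[i] by exact: sqr_i.
have GE j l : G j l = A 0 j * A 0 l + A 1 j * A 1 l + A 2 j * A 2 l.
  by rewrite mxE big_ord3 !mxE.
by apply: matrix2P; rewrite !mulmx2 det_mx33 4!mxE !GE !mxE;
  rewrite !pauli_frame_entries /=; ring: ii.
Qed.

Lemma pauli_adj (R : realType) j : (pauli R j)^t* = pauli R j.
Proof.
have aE (A : 'M[R[i]]_2) i k : A^t* i k = (A k i)^* by rewrite !mxE.
apply: matrix2P; rewrite aE !pauli_entries.
- by rewrite rmorph_nat.
- by rewrite rmorphD rmorphM !rmorph_nat /= conjC_i mulNr.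
- by rewrite rmorphB rmorphM !rmorph_nat /= conjC_i mulNr opprK.
- by rewrite rmorphN rmorph_nat.
Qed.

Lemma mxtrace_pauli (R : realType) j : \tr (pauli R j) = 0.
Proof. by rewrite mxtrace2 !pauli_entries subrr. Qed.

Lemma pauli_frame_inj (R : realType) (A B : 'M[R[i]]_3) :
  pauli_frame A =1 pauli_frame B -> A = B.
Proof.
move=> AB; apply/matrixP => k j.
have := mxtrace_pauli_frame B j k; rewrite -AB mxtrace_pauli_frame.
by apply: mulfI; rewrite pnatr_eq0.
Qed.

(** * The rotation of a unitary lies in SO(3) *)

Lemma conj_pauli (R : realType) (U : 'M[R[i]]_2) j : U \is unitarymx ->
  U *m pauli R j *m U^t* = pauli_frame (pauli_rotation U) j.
Proof.
move=> /unitarymxP/mulmx1C UU.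
rewrite [LHS](pauli_frame_trace0 j); last first.
  by rewrite mxtrace_mulC mulmxA UU mul1mx mxtrace_pauli.
by rewrite /pauli_frame; apply: eq_bigr => k _; rewrite !mxE.
Qed.

(** Lets a rotation matrix be read off from the action of U on the Pauli matrices, without computing
    traces. *)
Lemma pauli_rotation_unique (R : realType) (U : 'M[R[i]]_2) A :
  U \is unitarymx ->
  (forall j, U *m pauli R j *m U^t* = pauli_frame A j) -> pauli_rotation U = A.
Proof. by move=> uU UA; apply: pauli_frame_inj => j; rewrite -conj_pauli. Qed.

Lemma pauli_rotationM (R : realType) (U V : 'M[R[i]]_2) :
  U \is unitarymx -> V \is unitarymx ->
  pauli_rotation (U *m V) = pauli_rotation U *m pauli_rotation V.
Proof.
move=> uU uV; apply: pauli_rotation_unique => [|j]; first exact: mul_unitarymx.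
rewrite adjmxM !mulmxA -2!(mulmxA U) conj_pauli // /pauli_frame.
rewrite mulmx_sumr mulmx_suml.
under eq_bigr => l _.
  rewrite -scalemxAr -scalemxAl conj_pauli // /pauli_frame scaler_sumr; over.
rewrite exchange_big; apply: eq_bigr => k _ /=.
rewrite mxE scaler_suml; apply: eq_bigr => l _.
by rewrite scalerA mulrC.
Qed.

Lemma pauli_rotation1 (R : realType) :
  pauli_rotation (1%:M : 'M[R[i]]_2) = 1%:M.
Proof.
apply: pauli_rotation_unique => [|j].
  by apply/unitarymxP; rewrite trmx1 map_mx1 mulmx1.
by rewrite trmx1 map_mx1 mulmx1 mul1mx pauli_frame1.
Qed.

Lemma pauli_rotation_adj (R : realType) (U : 'M[R[i]]_2) :
  pauli_rotation (U^t*) = (pauli_rotation U)^T.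
Proof.
apply/matrixP => k j; rewrite !mxE trmxCK; congr (_ * _).
by rewrite -2!mulmxA mxtrace_mulC -!mulmxA mxtrace_mulC !mulmxA.
Qed.

Lemma pauli_rotation_orthogonal (R : realType) (U : 'M[R[i]]_2) :
  U \is unitarymx -> pauli_rotation U *m (pauli_rotation U)^T = 1%:M.
Proof.
move=> uU; rewrite -pauli_rotation_adj -pauli_rotationM ?trmxC_unitary //.
by rewrite (unitarymxP uU) pauli_rotation1.
Qed.

Lemma pauli_frame_prod (R : realType) (A : 'M[R[i]]_3) : A *m A^T = 1%:M ->
  pauli_frame A 0 *m pauli_frame A 1 *m pauli_frame A 2 =
  ('i%C * \det A)%:M.
Proof.
move=> /mulmx1C AA; rewrite pauli_frame_mul3 AA !mxE /=.
by rewrite !scale0r subrr !addr0.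
Qed.

Lemma pauli_prod (R : realType) :
  pauli R 0 *m pauli R 1 *m pauli R 2 = ('i%C)%:M.
Proof.
rewrite -!pauli_frame1 pauli_frame_prod ?det1 ?mulr1 //.
by rewrite trmx1 mulmx1.
Qed.

Lemma complexi_neq0 (R : realType) : 'i%C != 0 :> R[i].
Proof. by rewrite -sqrf_eq0 (sqr_i R) oppr_eq0 oner_eq0. Qed.

Lemma pauli_rotation_det (R : realType) (U : 'M[R[i]]_2) :
  U \is unitarymx -> \det (pauli_rotation U) = 1.
Proof.
move=> uU; have /unitarymxP UU := uU; have UU' := mulmx1C UU.
have := pauli_frame_prod (pauli_rotation_orthogonal uU).
(* The inner factors U^* U cancel, leaving the conjugate of the product of the three Pauli
   matrices. *)
rewrite -!conj_pauli // !mulmxA !mulmxKtV // -2!(mulmxA U).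
rewrite pauli_prod scalar_mxC -mulmxA UU mulmx1 => /matrixP/(_ 0 0).
rewrite !mxE /= !mulr1n -{1}['i%C]mulr1 => /(mulfI (complexi_neq0 R)).
by move=> <-.
Qed.

(** The trace of a product of two self-adjoint matrices is real: taking adjoints swaps the factors,
    and cyclicity swaps them back. *)
Lemma pauli_rotation_real (R : realType) (U : 'M[R[i]]_2) k j :
  (pauli_rotation U k j)^* = pauli_rotation U k j.
Proof.
have trC (A : 'M[R[i]]_2) : (\tr A)^* = \tr (A^t*).
  by rewrite -mxtrace_tr -trace_map_mx.
rewrite mxE rmorphM fmorphV rmorph_nat /= trC !adjmxM !pauli_adj trmxCK.
by rewrite mxtrace_mulC !mulmxA.
Qed.

Lemma pauli_rotation_SO (R : realType) (U : 'M[R[i]]_2) : U \is unitarymx ->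
  exists A : SO_group R 3, map_mx (real_complex R) A = pauli_rotation U.
Proof.
move=> uU; pose A := map_mx (@complex.Re R) (pauli_rotation U).
have AE : map_mx (real_complex R) A = pauli_rotation U.
  apply/matrixP => k j; rewrite [LHS]mxE [X in real_complex _ X]mxE.
  by apply: RRe_real; apply/CrealP; apply: pauli_rotation_real.
have AP : special_orthogonal A.
  apply/andP; split; apply/eqP.
    apply: (map_mx_inj (f := real_complex R)).
    by rewrite map_mxM -map_trmx AE map_mx1 pauli_rotation_orthogonal.
  apply: (fmorph_inj (real_complex R)).
  by rewrite -det_map_mx AE pauli_rotation_det ?rmorph1.
by exists (SOGroup AP).
Qed.

(** * Surjectivity onto SO(3) *)

Lemma pauli_frame_adj (R : realType) (A : 'M[R]_3) j :
  let T := pauli_frame (map_mx (real_complex R) A) j in T^t* = T.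
Proof.
rewrite /= /pauli_frame adjmx_sum; apply: eq_bigr => k _.
by rewrite adjmxZ pauli_adj mxE conj_Creal // complex_real.
Qed.

Lemma pauli_frame_sq (R : realType) (A : 'M[R[i]]_3) j : A *m A^T = 1%:M ->
  pauli_frame A j *m pauli_frame A j = 1%:M.
Proof.
move=> /mulmx1C AA; have := pauli_frame_anticomm A j j.
rewrite AA mxE eqxx mulr1 => TT.
apply: (scalerI (a := 2 : R[i])); first by rewrite pnatr_eq0.
by rewrite scale_scalar_mx mulr1 -TT scaler_nat.
Qed.

Lemma pauli_frame_skew (R : realType) (A : 'M[R[i]]_3) : A *m A^T = 1%:M ->
  pauli_frame A 0 *m pauli_frame A 2 = - (pauli_frame A 2 *m pauli_frame A 0).
Proof.
move=> /mulmx1C AA; have := pauli_frame_anticomm A 0 2.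
by rewrite AA mxE mulr0 raddf0 => /eqP; rewrite addr_eq0 => /eqP.
Qed.

(** Expresses T_1 through T_0 and T_2, so that an intertwiner need only be checked on those two. *)
Lemma pauli_frame_mid (R : realType) (A : 'M[R[i]]_3) : A *m A^T = 1%:M ->
  \det A = 1 -> pauli_frame A 1 = 'i%C *: (pauli_frame A 0 *m pauli_frame A 2).
Proof.
move=> AA dA; have := pauli_frame_prod AA; rewrite dA mulr1 => T012.
have T12 : pauli_frame A 1 *m pauli_frame A 2 = 'i%C *: pauli_frame A 0.
  rewrite -[LHS]mul1mx -(pauli_frame_sq 0 AA) -mulmxA.
  by rewrite (mulmxA _ (pauli_frame A 1)) T012 mul_mx_scalar.
by rewrite -[LHS]mulmx1 -(pauli_frame_sq 2 AA) mulmxA T12 -scalemxAl.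
Qed.

(* [T 2] is an involution other than -1, so it fixes some unit vector w; since
   [T 0] anticommutes with [T 2], it maps w to the -1 eigenline, and w, T 0 w
   are the columns of [U]. *)
Lemma pauli_intertwiner (R : realType) (T : 'I_3 -> 'M[R[i]]_2) :
  (T 0)^t* = T 0 -> (T 2)^t* = T 2 ->
  T 0 *m T 0 = 1%:M -> T 2 *m T 2 = 1%:M -> T 0 *m T 2 = - (T 2 *m T 0) ->
  exists U : 'M[R[i]]_2, [/\ U \is unitarymx, T 0 *m U = U *m pauli R 0 &
                             T 2 *m U = U *m pauli R 2].
Proof.
move=> adj0 adj2 sq0 sq2 skew.
(* Otherwise T_2 = -1 commutes with T_0, and anticommutation forces T_0 = 0, against T_0^2 = 1. *)
have [j vj0] : exists j, col j (1%:M + T 2) != 0.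
  apply/existsP; apply: contraT; rewrite negb_exists => /forallP c0.
  have T2E : T 2 = - 1%:M.
    apply/eqP; rewrite -addr_eq0 addrC; apply/eqP/matrixP => i j.
    have := c0 j; rewrite negbK => /eqP/matrixP/(_ i 0).
    by rewrite !mxE.
  have /eqP := skew; rewrite T2E mulmxN mulmx1 mulNmx mul1mx opprK eq_sym.
  rewrite -addr_eq0 -mulr2n -scaler_nat scaler_eq0 pnatr_eq0 /= => /eqP T00.
  have /matrixP/(_ 0 0) := sq0; rewrite T00 mul0mx !mxE => /esym/eqP.
  by rewrite oner_eq0.
set v := col j _ in vj0.
(* Indeed T_2 (1 + T_2) = 1 + T_2, because T_2 squares to 1. *)
have T2v : T 2 *m v = v.
  by rewrite /v colE mulmxA mulmxDr mulmx1 sq2 addrC.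
pose s := (v^t* *m v) 0 0.
have s_gt0 : 0 < s.
  rewrite lt_def mulmx_adj_ge0 andbT; apply: contraNneq vj0.
  by move=> /mulmx_adj_eq0 ->.
pose w := (sqrtC s)^-1 *: v.
have T2w : T 2 *m w = w by rewrite -scalemxAr T2v.
have ww : w^t* *m w = 1%:M.
  rewrite adjmxZ -scalemxAl -scalemxAr scalerA [v^t* *m v]mx11_scalar -/s.
  rewrite geC0_conj ?invr_ge0 ?sqrtC_ge0 ?ltW // -expr2 exprVn sqrtCK.
  by rewrite scale_scalar_mx mulVf ?gt_eqF.
(* Eigenvectors of the self-adjoint T_2 for the eigenvalues 1 and -1 are orthogonal; here the
   product equals its own opposite. *)
have wT0w : w^t* *m (T 0 *m w) = 0.
  have E : w^t* *m (T 0 *m w) = - (w^t* *m (T 0 *m w)).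
    rewrite -{1}T2w adjmxM adj2 -!mulmxA (mulmxA (T 2)) -[T 2 *m T 0]opprK.
    by rewrite -skew mulNmx -mulmxA T2w mulmxN.
  move/eqP: E; rewrite -addr_eq0 -mulr2n -scaler_nat scaler_eq0 pnatr_eq0 /=.
  by move/eqP.
have T0wT0w : (T 0 *m w)^t* *m (T 0 *m w) = 1%:M.
  by rewrite adjmxM adj0 -mulmxA (mulmxA (T 0)) sq0 mul1mx.
have T0ww : (T 0 *m w)^t* *m w = 0 by rewrite adjmxM adj0 -mulmxA.
pose U : 'M[R[i]]_2 := \matrix_(i, j) (if j == 0 then w else T 0 *m w) i 0.
have U0 : col 0 U = w by apply/matrixP => i k; rewrite ord1 !mxE.
have U1 : col 1 U = T 0 *m w by apply/matrixP => i k; rewrite ord1 2!mxE.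
have colP (A B : 'M[R[i]]_2) : col 0 A = col 0 B -> col 1 A = col 1 B -> A = B.
  move=> /matrixP A0 /matrixP A1; apply/matrixP => i; apply: ord2P.
    by have := A0 i 0; rewrite !mxE.
  by have := A1 i 0; rewrite !mxE.
have colM (A B : 'M[R[i]]_2) k : col k (A *m B) = A *m col k B.
  by rewrite !colE mulmxA.
have col_pauli k l : col k (U *m pauli R l) =
    pauli R l 0 k *: w + pauli R l 1 k *: (T 0 *m w).
  apply/matrixP => i m; rewrite [m]ord1 mxE mulmx2 [RHS]mxE.
  rewrite [X in _ = X + _]mxE [X in _ = _ + X]mxE.
  have -> : U i 0 = w i 0 by rewrite mxE.
  have -> : U i 1 = (T 0 *m w) i 0 by rewrite mxE.
  by rewrite ![_ * pauli _ _ _ _]mulrC.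
exists U; split.
- apply/unitarymxP/mulmx1C/matrixP.
  have UE k l : (U^t* *m U) k l = ((col k U)^t* *m col l U) 0 0.
    by rewrite !mxE; apply: eq_bigr => m _; rewrite !mxE.
  by apply: ord2P; apply: ord2P;
    rewrite UE ?U0 ?U1 ?ww ?wT0w ?T0ww ?T0wT0w !mxE.
- apply: colP; rewrite colM ?U0 ?U1 col_pauli !pauli_entries /=.
    by rewrite mulr0 addr0 scale0r scale1r add0r.
  by rewrite mulr0 subr0 oppr0 scale1r scale0r addr0 mulmxA sq0 mul1mx.
- apply: colP; rewrite colM ?U0 ?U1 col_pauli !pauli_entries /=.
    by rewrite mulr0 addr0 scale0r scale1r addr0.
  rewrite mulr0 subr0 scale0r add0r scaleN1r mulmxA -[T 2 *m T 0]opprK.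
  by rewrite -skew mulNmx -mulmxA T2w.
Qed.

Lemma pauli_rotation_onto (R : realType) (A : SO_group R 3) :
  exists U : 'M[R[i]]_2,
    special_unitary U /\ pauli_rotation U = map_mx (real_complex R) A.
Proof.
set B := map_mx _ A.
have /andP[/eqP oA /eqP dA] := SO_mxP A.
have oB : B *m B^T = 1%:M by rewrite /B map_trmx -map_mxM oA map_mx1.
have dB : \det B = 1 by rewrite det_map_mx dA rmorph1.
have [U [uU TU0 TU2]] := pauli_intertwiner
  (pauli_frame_adj A 0) (pauli_frame_adj A 2) (pauli_frame_sq 0 oB)
  (pauli_frame_sq 2 oB) (pauli_frame_skew oB).
(* The Pauli matrices are the frame of the identity, so the formula for T_1 holds for them too. *)
have pauli_mid : pauli R 1 = 'i%C *: (pauli R 0 *m pauli R 2).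
  by rewrite -!pauli_frame1 pauli_frame_mid ?det1 // trmx1 mulmx1.
have TU1 : pauli_frame B 1 *m U = U *m pauli R 1.
  rewrite pauli_mid (pauli_frame_mid oB dB) -scalemxAl -scalemxAr -mulmxA TU2.
  by rewrite mulmxA TU0 mulmxA.
have TU k : pauli_frame B k *m U = U *m pauli R k by move: k; apply: ord3P.
have [V [sV VU]] := special_unitary_normalize uU.
have /andP[uV _] := sV.
exists V; split=> //; apply: pauli_rotation_unique => // k.
by rewrite VU -TU mulmxtVK.
Qed.

(** * Injectivity and the group isomorphism *)

Lemma conj_pauli_rotation_inj (R : realType) (U V : 'M[R[i]]_2) :
  U \is unitarymx -> V \is unitarymx -> pauli_rotation U = pauli_rotation V ->
  forall X, U *m X *m U^t* = V *m X *m V^t*.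
Proof.
(* Split X into a scalar part, fixed by both conjugations, and a traceless part, a combination of
   Pauli matrices. *)
move=> uU uV UV X; set a := 2^-1 * \tr X.
have trX : \tr (X - a%:M) = 0.
  by rewrite linearB /= mxtrace_scalar -mulr_natl /a mulVKf ?subrr ?pnatr_eq0.
rewrite -(subrK a%:M X); move: (X - a%:M) trX => Y trY.
rewrite !mulmxDr !mulmxDl; congr (_ + _); last first.
  by rewrite !scalar_mxC -!mulmxA (unitarymxP uU) (unitarymxP uV).
rewrite (pauli_frame_trace0 0 trY) /pauli_frame !mulmx_sumr !mulmx_suml.
apply: eq_bigr => k _; rewrite -!scalemxAr -!scalemxAl.
by rewrite (conj_pauli _ uU) (conj_pauli _ uV) UV.
Qed.

Theorem mainTheorem3 (R : realType) :
  (* every element of G is conjugation by some U in SU(2) *)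
  (forall Phi : CPTP_group R[i] 2,
     exists U : 'M[R[i]]_2,
       special_unitary U /\ conjugation_by U Phi) /\
  (* independence of the choice of U *)
  (forall (Phi : CPTP_group R[i] 2) (U V : 'M[R[i]]_2),
     special_unitary U -> conjugation_by U Phi ->
     special_unitary V -> conjugation_by V Phi ->
     pauli_rotation U = pauli_rotation V) /\
  (* the assignment is a group isomorphism onto SO(3) *)
  (exists f : CPTP_group R[i] 2 -> SO_group R 3,
     [/\ forall (Phi : CPTP_group R[i] 2) (U : 'M[R[i]]_2),
           special_unitary U -> conjugation_by U Phi ->
           map_mx (real_complex R) (f Phi) = pauli_rotation U,
         {morph f : Phi Psi / (Phi * Psi)%g >-> (Phi * Psi)%g}
       & bijective f]).
Proof.
have uP (Phi : CPTP_group R[i] 2) : exists U : 'M[R[i]]_2,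
    special_unitary U /\ conjugation_by U Phi.
  have [U [uU UPhi]] := CPTP_invertible_unitary (asboolW (CPTP_mapP Phi)).
  have [V [sV VU]] := special_unitary_normalize uU.
  by exists V; split=> // X; rewrite UPhi VU.
have indep (Phi : CPTP_group R[i] 2) (U V : 'M[R[i]]_2) :
    special_unitary U -> conjugation_by U Phi ->
    special_unitary V -> conjugation_by V Phi ->
    pauli_rotation U = pauli_rotation V.
  (* The entries involve U only through the images of the Pauli matrices under [Phi]. *)
  move=> _ UPhi _ VPhi; apply/matrixP => k j.
  by rewrite !mxE -UPhi -VPhi.
split=> //; split=> //.
have fP (Phi : CPTP_group R[i] 2) : exists A : SO_group R 3,
    forall U : 'M[R[i]]_2, special_unitary U -> conjugation_by U Phi ->
    map_mx (real_complex R) A = pauli_rotation U.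
  have [U [sU UPhi]] := uP Phi; have /andP[uU _] := sU.
  have [A AU] := pauli_rotation_SO uU; exists A => V sV VPhi.
  by rewrite AU; apply: indep VPhi.
have [f fE] := choice fP.
have f_inj : injective f.
  move=> Phi Psi fPQ.
  have [U [sU UPhi]] := uP Phi; have [V [sV VPsi]] := uP Psi.
  have /andP[uU _] := sU; have /andP[uV _] := sV.
  have UV : pauli_rotation U = pauli_rotation V.
    by rewrite -(fE _ _ sU UPhi) fPQ (fE _ _ sV VPsi).
  apply: val_inj; apply/lfunP => X /=; rewrite UPhi VPsi.
  exact: conj_pauli_rotation_inj.
have f_onto A : exists Phi, f Phi = A.
  have [U [sU UA]] := pauli_rotation_onto A; have /andP[uU _] := sU.
  exists (CPTPGroup (asboolT (CPTP_invertible_conj_channel uU))).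
  apply: val_inj; apply: (map_mx_inj (f := real_complex R)).
  by rewrite -UA; apply: fE => //=; apply: conj_channelE.
exists f; split=> [//|Phi Psi|]; last first.
  have [g gK] := choice f_onto.
  by exists g => // Phi; apply: f_inj; rewrite gK.
(* The product U V is special unitary and represents the composite, so multiplicativity of
   [pauli_rotation] carries over to f. *)
have [U [sU UPhi]] := uP Phi; have [V [sV VPsi]] := uP Psi.
have /andP[uU /eqP dU] := sU; have /andP[uV /eqP dV] := sV.
apply: val_inj; apply: (map_mx_inj (f := real_complex R)).
rewrite /= map_mxM (fE _ _ sU UPhi) (fE _ _ sV VPsi) -(pauli_rotationM uU uV).
apply: fE => [|X].
  by rewrite /special_unitary mul_unitarymx // det_mulmx dU dV mulr1 eqxx.
by rewrite lfunE /= VPsi UPhi adjmxM !mulmxA.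
Qed.
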